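(* Let $e\ge 0$ and $t>1$ be integers, $q=(2e+1)t$, $d_1=\gcd(2e+1,t)$ and $h_1=\frac{2e+1}{d_1}$. The map $$\psi:\mathbb{Z}_{d_1}\to LPL^{\infty}(2,e,q)_o,\qquad k+d_1\mathbb{Z}\mapsto LC_q(e,k),$$ is a well-defined bijection, and it induces bijections $$\psi_{\mathcal{G}}:\frac{\mathbb{Z}_{d_1}}{\{1,-1\}}\to LPL^{\infty}(2,e,q)_o/\mathcal{G},\qquad k\cdot\{1,-1\}\mapsto[\psi(k)]_{\mathcal{G}},$$ and $$\psi_{\mathcal{A}}:\frac{\mathbb{Z}_{d_1}}{\mathbb{Z}_{d_1}^{*}}\to LPL^{\infty}(2,e,q)_o/\mathcal{A},\qquad k\cdot\mathbb{Z}_{d_1}^{*}\mapsto[\psi(k)]_{\mathcal{A}}.$$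
   Context: For $a\in\mathbb{Z}_q$ with representative $\tilde a\in\{0,\dots,q-1\}$ put $|a|_1=\min\{\tilde a,q-\tilde a\}$. The maximum metric on $\mathbb{Z}_q^n$ is $d(x,y)=\max_i|x_i-y_i|_1$, and $B(x,r)=\{y\in\mathbb{Z}_q^n: d(x,y)\le r\}$. $LPL^{\infty}(n,e,q)$ is the set of linear perfect codes with packing radius $e$, i.e. of subgroups $C$ of $(\mathbb{Z}_q^n,+)$ with $\#C>1$ such that $\mathbb{Z}_q^n$ is the disjoint union of the balls $B(c,e)$, $c\in C$. $LPL^{\infty}(2,e,q)_o$ is the subset of those $C\in LPL^{\infty}(2,e,q)$ that are of type $2$, i.e. $C+(2e+1)e_2\subseteq C$ where $e_2=(0,1)$. $LC_q(e,k)$ denotes the code in $LPL^{\infty}(2,e,q)$ with generator matrix $\begin{pmatrix}2e+1 & kh_1\\ 0& 2e+1\end{pmatrix}$, i.e. the subgroup of $\mathbb{Z}_q^2$ generated by the residue classes modulo $q$ of its rows. $\mathcal{G}$ is the group of linear isometries of $\mathbb{Z}_q^2$, i.e. of group homomorphisms $\mathbb{Z}_q^2\to\mathbb{Z}_q^2$ preserving the maximum norm $|x|_\infty=d(x,0)$ (for $q>3$ these are the signed permutations of the coordinates). Two codes $C_1,C_2$ are $\mathcal{G}$-equivalent if $C_1=f(C_2)$ for some $f\in\mathcal{G}$; they are $\mathcal{A}$-equivalent if $C_1=f(C_2)$ for some group automorphism $f$ of $\mathbb{Z}_q^2$. $X/\mathcal{G}$, $X/\mathcal{A}$ denote the sets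 of equivalence classes of the codes in $X$, and $[C]_{\mathcal{G}}$, $[C]_{\mathcal{A}}$ the classes of $C$. For a commutative ring $A$ with unit and a subgroup $S$ of its group of units $A^{*}$, $A/S=\{xS: x\in A\}$ is the set of generalized cosets $xS=\{xs:s\in S\}$ (these partition $A$). *)

(* Defs.v *)
From HB Require Import structures.
From mathcomp Require Import all_boot all_order all_algebra all_fingroup.

Set Implicit Arguments.
Unset Strict Implicit.
Unset Printing Implicit Defensive.

Import GRing.Theory.
Local Open Scope ring_scope.

(* The ring Z/dZ for every d > 0, including the zero ring for d = 1 (the      *)
(* library's 'Z_1 is Z/2Z).                                                   *)
Definition Zmod (d : nat) := 'I_(d.-1).+1.

HB.instance Definition _ (d : nat) := Finite.on (Zmod d).
HB.instance Definition _ (d : nat) := GRing.Zmodule.on (Zmod d).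
HB.instance Definition _ (d : nat) :=
  GRing.Zmodule_isComPzRing.Build (Zmod d)
    (@Zp_mulA _) (@Zp_mulC _) (@Zp_mul1z _) (@Zp_mul_addl _).

Section GeneralizedCosets.
Variable A : finComPzRingType.

(* GRing.unit is unavailable here, as it excludes the zero ring. *)
Definition unit_set : {set A} := [set x | [exists y, x * y == 1]].

Definition gcoset (x : A) (S : {set A}) : {set A} := [set x * s | s in S].

Definition gcosets (S : {set A}) : {set {set A}} := [set gcoset x S | x : A].

End GeneralizedCosets.

(* 'Z_q is Z/qZ only for q > 1; all codes below are used with q > 1. The      *)
(* group law of {group 'rV['Z_q]_n} is the addition of vectors.               *)
Section Codes.
Variables n q : nat.
Notation V := 'rV['Z_q]_n.

Definition norm1 (a : 'Z_q) : nat := minn a (q - a).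

Definition dist (x y : V) : nat := (\max_(i < n) norm1 (x 0 i - y 0 i)%R)%N.

Definition ball (x : V) (r : nat) : {set V} := [set y | (dist x y <= r)%N].

Definition perfect (e : nat) (C : {set V}) : bool :=
  (\bigcup_(c in C) ball c e == [set: V])
  && [forall c in C, forall c' in C,
        (c != c') ==> [disjoint ball c e & ball c' e]].

Definition LPL (e : nat) : {set {group V}} :=
  [set C : {group V} | (1 < #|C|)%N && perfect e C].

(* Group endomorphisms preserving the maximum norm; these are automatically   *)
(* bijective.                                                                 *)
Definition linear_isometries : {set {ffun V -> V}} :=
  [set f : {ffun V -> V} |
     [forall x, forall y, f (x + y) == f x + f y]
     && [forall x, dist (f x) 0 == dist x 0]].

Definition Gequiv (C1 C2 : {group V}) : bool :=
  [exists f in linear_isometries, C1 == f @: C2 :> {set V}].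

Definition Aequiv (C1 C2 : {group V}) : bool :=
  [exists f in Aut [set: V], C1 == f @: C2 :> {set V}].

End Codes.

Arguments LPL : clear implicits.
Arguments Gequiv {n q}.
Arguments Aequiv {n q}.

(* The class of x inside X; the set of all these classes is                   *)
(* equivalence_partition R X.                                                 *)
Definition eq_class (T : finType) (R : rel T) (X : {set T}) (x : T) : {set T} :=
  [set y in X | R x y].

Definition LPLo (e q : nat) : {set {group 'rV['Z_q]_2}} :=
  [set C in LPL 2 q e |
     [set c + delta_mx 0 1 *+ (2 * e + 1) | c in C] \subset C].

Definition code_of_matrix (q m n : nat) (M : 'M[int]_(m, n)) :
    {group 'rV['Z_q]_n} :=
  <<[set row i (map_mx intr M) | i : 'I_m]>>%G.

Definition LC (q e h1 : nat) (k : int) : {group 'rV['Z_q]_2} :=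
  @code_of_matrix q 2 2
    (\matrix_(i, j)
       (nth [::] [:: [:: (2 * e + 1)%N%:Z; k * h1%:Z];
                     [:: 0;                (2 * e + 1)%N%:Z]] i)`_j).

Definition bij_between (S T : finType) (A : {set S}) (B : {set T}) (f : S -> T)
    : Prop :=
  {in A &, injective f} /\ f @: A = B.

(* Main.v *)
From HB Require Import structures.
Require Import Defs.
From mathcomp Require Import all_boot all_order all_algebra all_fingroup.
From mathcomp Require Import zify ring.

(** Put p = 2e+1, so that q = pt.  Everything is done with integer coordinates:
[vec q x y] is the class modulo q of (x, y).  The code [LC q e h1 k] is the
image of the lattice L(k) spanned by (p, k h1) and (0, p).  Since d1 = gcd(p, t)
and p = h1 d1, the product t h1 is a multiple of p, so L(k) contains q Z^2, and
membership in the code is membership in L(k), with no reduction modulo q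
([mem_LC]).

Geometrically, L(k) cuts the plane into columns of width p, each tiled by
squares of side p, where every column is shifted by k h1 with respect to its
left neighbour; hence the code is perfect ([LC_LPLo]).  Conversely, a perfect
code containing (0, p) has nothing but multiples of (0, p) on the vertical axis
and no word with first coordinate in [1, 2e].  The word covering (e+1, 0) must
then be some (p, y).  Its multiple by t lies on the vertical axis, so p divides
t y, that is, h1 divides y, and the code is [LC q e h1 k] for k = y / h1
([LC_surj]).  The vertical axis also shows that k is determined modulo d1
([LC_eqP]).

For the two equivalences, the map (x, y) -> (x, u y) sends the code of k to
the code of u k as soon as u is invertible modulo q ([scale2_LC]).
- It is an isometry for u = -1, so k and -k give equivalent codes.  Conversely,
  if e > 0 then q > 3 and an isometry is a signed permutation
  ([signed_permutation]).  A diagonal one yields k = l or k = -l modulo d1; one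
  that exchanges the axes can only relate codes with k = l = 0 ([Gequiv_LCP]).
- Every unit modulo d1 lifts to a unit modulo q ([coprimez_lift]), so associate
  elements of Z/d1 give codes in the same orbit of the automorphism group.
  Conversely an automorphism preserves the divisors g of q such that all the
  words of the code are multiples of g; hence it preserves gcd(p, k h1) =
  h1 gcd(d1, k), and elements of Z/d1 with the same gcd with d1 are associate
  ([associates_mod], [Aequiv_LCP]).

Finally, a bijection under which a relation becomes equality of generalized
cosets induces a bijection between the cosets and the classes
([induced_bijection]). *)

Set Implicit Arguments.
Unset Strict Implicit.
Unset Printing Implicit Defensive.

Import Order.TTheory GRing.Theory Num.Theory.
Local Open Scope ring_scope.

(** * Arithmetic modulo d *)

(** The units of Z/n map onto those of Z/m when m divides n: the Chinese
remainder theorem gives v congruent to u modulo m and to 1 modulo the part of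
n prime to m, so no prime factor of n can divide v. *)
Lemma coprimez_lift (m n : nat) (u : int) :
  (m %| n)%N -> (0 < n)%N -> coprimez u m ->
  exists2 v : int, (m %| v - u)%Z & coprimez v n.
Proof.
move=> dvd_mn n_gt0 cop_um; pose s := (n`_(\pi(m)^'))%N.
have cop_ms : coprimez m s.
  have m_gt0 := dvdn_gt0 n_gt0 dvd_mn.
  by rewrite coprimezE !absz_nat coprime_pi' ?part_gt0 ?part_pnat.
have /eqP := zchinese_modl cop_ms u 1; have /eqP := zchinese_modr cop_ms u 1.
move: (zchinese _ _ _ _) => v; rewrite !eqz_mod_dvd => dvd_s dvd_m.
exists v => //; rewrite coprimezE absz_nat; apply: contraT => not_cop.
pose r := pdiv (gcdn `|v| n).
have r_pr : prime r.
  by rewrite pdiv_prime // ltn_neqAle eq_sym not_cop gcdn_gt0 n_gt0 orbT.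
have /andP[r_v r_n] : (r %| `|v|)%N && (r %| n)%N.
  by rewrite -dvdn_gcd pdiv_dvd.
have [r_m | r_m] := boolP (r %| m)%N.
  have : (r %| gcdz u m)%Z.
    rewrite dvdz_gcd [X in _ && X]dvdzE r_m andbT.
    by rewrite -(subKr v u) rpredB //; apply: dvdz_trans dvd_m; rewrite dvdzE.
  by rewrite (eqP cop_um) dvdz1 absz_nat => /eqP r1; rewrite r1 in r_pr.
have r_s : (r %| s)%N.
  have m_gt0 := dvdn_gt0 n_gt0 dvd_mn.
  rewrite -[n](@partnC \pi(m)) // Euclid_dvdM // in r_n.
  case/orP: r_n => // r_n.
  have := pnatP _ (part_gt0 \pi(m) n) (part_pnat \pi(m) n) r r_pr r_n.
  by rewrite mem_primes r_pr m_gt0 (negPf r_m).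
have : (r %| 1%R)%Z.
  by rewrite -(subKr v 1) rpredB //; apply: dvdz_trans dvd_s; rewrite dvdzE.
by rewrite dvdz1 absz_nat => /eqP r1; rewrite r1 in r_pr.
Qed.

(** If k and l have the same gcd g with d, then k/g and l/g are invertible
modulo d/g; their quotient there lifts to a unit modulo d. *)
Lemma associates_mod (d : nat) (k l : int) : (0 < d)%N ->
  (gcdz d k %| l)%Z -> (gcdz d l %| k)%Z ->
  exists2 u : int, coprimez u d & (d %| k - u * l)%Z.
Proof.
move=> d_gt0 dvd_l dvd_k.
have eq_g : gcdz d k = gcdz d l.
  apply/eqP; rewrite eqz_nat eqn_dvd; apply/andP; split.
    have : (gcdz d k %| gcdz d l)%Z by rewrite dvdz_gcd dvdz_gcdl.
    by rewrite dvdzE.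
  have : (gcdz d l %| gcdz d k)%Z by rewrite dvdz_gcd dvdz_gcdl.
  by rewrite dvdzE.
have [x [y Bk]] := Bezoutz d k; have [x' [y' Bl]] := Bezoutz d l.
move: (dvdz_gcdl d k) (dvdz_gcdr d k) (dvdz_gcdr d l) Bk Bl.
have g_neq0 : gcdz d k != 0 by rewrite gcdz_eq0 negb_and -lt0n d_gt0.
rewrite -eq_g; move: (gcdz d k) g_neq0 => g g_neq0.
move=> /dvdzP[m dE] /dvdzP[a kE] /dvdzP[b lE] Bk Bl.
have {}Bk : x * m + y * a = 1.
  by apply: (mulIf g_neq0); rewrite mul1r -[RHS]Bk dE kE; ring.
have {}Bl : x' * m + y' * b = 1.
  by apply: (mulIf g_neq0); rewrite mul1r -[RHS]Bl dE lE; ring.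
have dvd_md : (`|m| %| d)%N by rewrite -[d]/`|d%:Z|%N dE abszM dvdn_mulr.
have cop_m : coprimez (a * y') `|m|%N.
  suff: coprimez (a * y') m by rewrite !coprimezE absz_nat.
  apply/coprimezP; exists (y * b, x + x' - x * x' * m) => /=.
  have -> : 1 = (x * m + y * a) * (x' * m + y' * b) by rewrite Bk Bl.
  have -> : y * b * (a * y') = (y * a) * (y' * b) by ring.
  have -> : y * a = 1 - x * m by rewrite -Bk; ring.
  have -> : y' * b = 1 - x' * m by rewrite -Bl; ring.
  by ring.
have [v /dvdzP[w vE] cop_vd] := coprimez_lift dvd_md d_gt0 cop_m.
exists v => //.
have dvd_m : (m %| a - v * b)%Z.
  have -> : a - v * b = x' * a * m - w * b * `|m|%N.
    have -> : v = w * `|m|%N + a * y' by rewrite -vE; ring.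
    have -> : x' * a * m = a * (1 - y' * b) by rewrite -Bl; ring.
    by ring.
  by rewrite rpredB // dvdz_mull // dvdzE absz_nat.
by rewrite dE kE lE mulrA -mulrBl dvdz_mul.
Qed.

(** The criterion is shared by [Zmod d], for every positive d, and ['Z_q], for
q > 1. *)
Lemma intr_nat_dvdz (R : pzRingType) (d : nat) (z : int) :
  (forall n : nat, (n%:R == 0 :> R) = (d %| n)%N) ->
  (z%:~R == 0 :> R) = (d %| z)%Z.
Proof.
move=> natE; rewrite dvdzE /= -natE; case: (intP z) => // n.
  by rewrite mulrNz oppr_eq0.
Qed.

Lemma intr_Zmod_eq0 (d : nat) (z : int) : (0 < d)%N ->
  (z%:~R == 0 :> Zmod d) = (d %| z)%Z.
Proof.
move=> d_gt0; apply: intr_nat_dvdz => n.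
have -> : (n%:R : Zmod d) = inZp 1 *+ n by [].
by rewrite Zp_mulrn -val_eqE /= modnMml mul1n prednK.
Qed.

Lemma intr_Zmod_eq (d : nat) (y z : int) : (0 < d)%N ->
  (y%:~R == z%:~R :> Zmod d) = (d %| y - z)%Z.
Proof. by move=> d_gt0; rewrite -intr_Zmod_eq0 // rmorphB subr_eq0. Qed.

Lemma intr_val_Zmod (d : nat) (k : Zmod d) : (k : nat)%:Z%:~R = k.
Proof.
have -> : (k : nat)%:Z%:~R = inZp 1 *+ k :> Zmod d by [].
by apply: val_inj; rewrite Zp_mulrn /= modnMml mul1n modn_small.
Qed.

Lemma intr_Zp_eq0 (q : nat) (z : int) : (1 < q)%N ->
  (z%:~R == 0 :> 'Z_q) = (q %| z)%Z.
Proof.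
by move=> q_gt1; apply: intr_nat_dvdz => n; rewrite -val_eqE /= val_Zp_nat.
Qed.

Lemma intr_Zp_eq (q : nat) (y z : int) : (1 < q)%N ->
  (y%:~R == z%:~R :> 'Z_q) = (q %| y - z)%Z.
Proof. by move=> q_gt1; rewrite -intr_Zp_eq0 // rmorphB subr_eq0. Qed.

(** The norm is small exactly when some integer representative is: the least
residue a is within r of 0, or a - q is. *)
Lemma norm1_leP (q r : nat) (z : int) : (1 < q)%N ->
  reflect (exists2 w : int, `|w| <= r%:Z & (q %| z - w)%Z)
          (@Defs.norm1 q z%:~R <= r)%N.
Proof.
move=> q_gt1; set a : 'Z_q := z%:~R.
have a_lt : (a < q)%N by rewrite -[X in (_ < X)%N](Zp_cast q_gt1) ltn_ord.
have aE : a%:Z%:~R = a by rewrite -pmulrn natr_Zp.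
have dvd_a : (q %| z - a%:Z)%Z by rewrite -intr_Zp_eq // aE.
rewrite /Defs.norm1; apply: (iffP idP) => [|[w w_le dvd_w]].
  rewrite geq_min => /orP[a_le | qa_le]; first by exists a%:Z.
  exists (a%:Z - q%:Z); first by lia.
  by rewrite opprB addrCA rpredD.
have /dvdzP[m mE] : (q %| a%:Z - w)%Z.
  have -> : a%:Z - w = (z - w) - (z - a%:Z) by move: a%:Z => b; ring.
  exact: rpredB.
rewrite geq_min; case: (lerP m 0) => m0; apply/orP; [left | right]; nia.
Qed.

(** * Integer coordinates on the square of Z/q *)

Definition vec (q : nat) (x y : int) : 'rV['Z_q]_2 :=
  \row_j (if j == 0 then x else y)%:~R.

Section IntegerCoordinates.
Variable q : nat.
Hypothesis q_gt1 : (1 < q)%N.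
Implicit Types (x y : int) (C : {group 'rV['Z_q]_2}) (r e : nat).

Lemma vec00 : vec q 0 0 = 0.
Proof. by apply/rowP=> j; rewrite !mxE; case: eqP. Qed.

Lemma vec_surj (v : 'rV['Z_q]_2) : exists x y, v = vec q x y.
Proof.
exists (v 0 0 : nat)%:Z, (v 0 1 : nat)%:Z; apply/rowP=> j; rewrite mxE.
case: eqP => [-> | /eqP j_neq0]; rewrite -pmulrn natr_Zp //.
by congr (v 0 _); apply: val_inj; case: j j_neq0 => [[|[|]]].
Qed.

Lemma vecD x y x' y' : vec q x y + vec q x' y' = vec q (x + x') (y + y').
Proof. by apply/rowP=> j; rewrite !mxE -rmorphD; case: eqP. Qed.

Lemma vecN x y : - vec q x y = vec q (- x) (- y).
Proof. by apply/rowP=> j; rewrite !mxE -rmorphN; case: eqP. Qed.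

Lemma vecB x y x' y' : vec q x y - vec q x' y' = vec q (x - x') (y - y').
Proof. by rewrite vecN vecD. Qed.

Lemma vec_eq x y x' y' :
  (vec q x y == vec q x' y') = (q %| x - x')%Z && (q %| y - y')%Z.
Proof.
rewrite -!intr_Zp_eq //; apply/eqP/andP=> [/rowP eq_v | [/eqP eq_x /eqP eq_y]].
  by move: (eq_v 0) (eq_v 1); rewrite !mxE /= => -> ->.
by apply/rowP=> j; rewrite !mxE; case: (j == 0).
Qed.

Lemma vec_eqP x y x' y' :
  reflect (exists a b : int, x = x' + a * q /\ y = y' + b * q)
          (vec q x y == vec q x' y').
Proof.
rewrite vec_eq; apply: (iffP andP) => [[] | [a [b [-> ->]]]].
  move=> /dvdzP[a aE] /dvdzP[b bE].
  by exists a, b; rewrite -aE -bE; split; ring.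
by rewrite ![_ + _ * _]addrC !addrK !dvdz_mull.
Qed.

Lemma dist_vecP x y x' y' r :
  reflect (exists u w : int,
             [/\ `|u| <= r%:Z, `|w| <= r%:Z
               & vec q x y = vec q (x' + u) (y' + w)])
          (dist (vec q x y) (vec q x' y') <= r)%N.
Proof.
have -> : (dist (vec q x y) (vec q x' y') <= r)%N =
    (@Defs.norm1 q (x - x')%:~R <= r)%N && (@Defs.norm1 q (y - y')%:~R <= r)%N.
  rewrite /dist big_ord_recl big_ord1 geq_max.
  by rewrite !mxE /= -!rmorphB.
apply: (iffP andP) => [[] | [u [w [u_le w_le /eqP]]]].
  move=> /(norm1_leP _ _ q_gt1)[u u_le u_dvd].
  move=> /(norm1_leP _ _ q_gt1)[w w_le w_dvd].
  exists u, w; split=> //; apply/eqP.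
  by rewrite vec_eq !opprD !addrA u_dvd.
rewrite vec_eq !opprD !addrA => /andP[u_dvd w_dvd].
by split; apply/norm1_leP=> //; [exists u | exists w].
Qed.

Lemma dist_vec0P x y r :
  reflect (exists u w : int,
             [/\ `|u| <= r%:Z, `|w| <= r%:Z & vec q x y = vec q u w])
          (dist (vec q x y) 0 <= r)%N.
Proof.
rewrite -vec00.
by apply: (iffP (dist_vecP _ _ _ _ _)) => -[u [w [u_le w_le]]];
  rewrite ?add0r => vE; exists u, w; rewrite ?add0r.
Qed.

(** Balls of radius e around two words meet exactly when the difference of the
words has coordinates of size at most 2e; as the code is a group, only
differences with 0 matter. *)
Lemma perfectP C e :
  reflect
    [/\ forall x y, exists x' y' : int,
          [/\ vec q x' y' \in C, `|x - x'| <= e%:Z & `|y - y'| <= e%:Z]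
      & forall x y, vec q x y \in C ->
          `|x| <= (2 * e)%N%:Z -> `|y| <= (2 * e)%N%:Z -> vec q x y = 0]
    (perfect e C).
Proof.
apply: (iffP andP) => [[/eqP cover /forall_inP sep] | [cover sep]].
  split=> x y.
    have : vec q x y \in [set: 'rV['Z_q]_2] by rewrite inE.
    rewrite -cover => /bigcupP[c]; have [x' [y' ->]] := vec_surj c => c_C.
    rewrite inE => /dist_vecP[u [w [u_le w_le cE]]].
    exists (x + u), (y + w); rewrite -cE; split=> //; lia.
  move=> v_C x_le y_le; apply/eqP; apply: contraT => v_neq0.
  have /forall_inP/(_ _ (group1 C)) := sep _ v_C.
  rewrite v_neq0 => /pred0P.
  (* A midpoint of 0 and (x, y) would lie in two balls. *)
  have halve z : `|z| <= (2 * e)%N%:Z ->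
      exists2 u : int, `|u| <= e%:Z & `|z - u| <= e%:Z.
    move=> z_le; have [z_le_e|] := boolP (`|z| <= e%:Z).
      by exists 0; lia.
    by case: (lerP 0 z) => z0 z_gt; [exists e%:Z; lia | exists (- e%:Z); lia].
  have [[u u_le xu_le] [w w_le yw_le]] := (halve _ x_le, halve _ y_le).
  move/(_ (vec q u w)); rewrite /= !inE.
  suff -> : (dist (vec q x y) (vec q u w) <= e)%N.
    suff -> : (dist 1%g (vec q u w) <= e)%N by [].
    rewrite -[1%g]vec00.
    by apply/dist_vecP; exists (- u), (- w); rewrite !normrN !subrr.
  apply/dist_vecP; exists (x - u), (y - w).
  by rewrite !(addrC u) !(addrC w) !subrK.
split.
  apply/eqP/setP=> v; rewrite inE; have [x [y ->]] := vec_surj v.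
  have [x' [y' [c_C x_le y_le]]] := cover x y.
  apply/bigcupP; exists (vec q x' y') => //; rewrite inE.
  apply/dist_vecP; exists (x' - x), (y' - y).
  by rewrite !(addrC x) !(addrC y) !subrK !(distrC _ x) !(distrC _ y).
apply/forall_inP=> c c_C; apply/forall_inP=> c' c'_C; apply/implyP=> neq_cc'.
apply/pred0P=> z /=; apply: contraNF neq_cc'; rewrite !inE.
have [x [y cE]] := vec_surj c; have [x' [y' c'E]] := vec_surj c'.
have [s [t ->]] := vec_surj z; rewrite cE c'E.
move=> /andP[/dist_vecP[u [w [u_le w_le E]]]].
move=> /dist_vecP[u' [w' [u'_le w'_le E']]].
rewrite -subr_eq0 E E' vecB; apply/eqP.
apply: sep; try lia.
rewrite -vecB -E -E' -cE -c'E.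
exact: groupM c_C (groupVr c'_C).
Qed.

End IntegerCoordinates.

Lemma vecMn (q n : nat) (x y : int) :
  vec q x y *+ n = vec q (n%:Z * x) (n%:Z * y).
Proof.
by apply/rowP=> j; rewrite mulmxnE !mxE; case: eqP => _; rewrite intrM mulr_natl.
Qed.

Lemma group_vecMz (q : nat) (C : {group 'rV['Z_q]_2}) (z x y : int) :
  vec q x y \in C -> vec q (z * x) (z * y) \in C.
Proof.
move=> v_C; have nat_C n : vec q (n%:Z * x) (n%:Z * y) \in C.
  by rewrite -vecMn; apply: groupX.
case: z => n; first exact: nat_C.
by rewrite NegzE !mulNr -vecN; apply: groupVr.
Qed.

(** * Additive maps and isometries *)

Lemma additive_vec (q : nat) (f : 'rV['Z_q]_2 -> 'rV['Z_q]_2) :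
  {morph f : x y / x + y} ->
  exists a b c d : int, forall x y : int,
    f (vec q x y) = vec q (a * x + c * y) (b * x + d * y).
Proof.
move=> fD; have fB : {morph f : x y / x - y}.
  by move=> x y; apply: (addIr (f y)); rewrite -fD !subrK.
pose F : {additive 'rV['Z_q]_2 -> 'rV['Z_q]_2} :=
  HB.pack f (GRing.isZmodMorphism.Build _ _ f fB).
have vecMz (z x y : int) : vec q x y *~ z = vec q (z * x) (z * y).
  case: z => n; first exact: vecMn.
  by rewrite NegzE mulrNz !mulNr -vecN -vecMn.
have [a [b fE1]] := vec_surj (f (vec q 1 0)).
have [c [d fE2]] := vec_surj (f (vec q 0 1)).
exists a, b, c, d => x y.
have -> : vec q x y = vec q 1 0 *~ x + vec q 0 1 *~ y.
  by rewrite !vecMz vecD !mulr1 !mulr0 addr0 add0r.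
rewrite -[f]/(F : _ -> _) raddfD !raddfMz /= fE1 fE2 !vecMz vecD.
by rewrite !(mulrC x) !(mulrC y).
Qed.

Lemma abs1P (z : int) : `|z| = 1 -> z = 1 \/ z = -1. Proof. lia. Qed.

Lemma abs1_sqr (z : int) : `|z| = 1 -> z * z = 1.
Proof. by case/abs1P=> ->. Qed.

Lemma dvdz_abs1 (d s z : int) : `|s| = 1 -> (d %| s * z)%Z = (d %| z)%Z.
Proof. by case/abs1P=> ->; rewrite ?mul1r // mulN1r rpredN. Qed.

(** The images (a, b) and (c, d) of the basis vectors, and their sum and
difference, have norm at most 1.  As q > 3, this forces ac = bd = 0 for
representatives in {-1, 0, 1}, and neither image vanishes. *)
Lemma signed_permutation (q : nat) (a b c d : int) : (3 < q)%N ->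
  (forall x y : int, dist (vec q (a * x + c * y) (b * x + d * y)) 0
                     = dist (vec q x y) 0) ->
  exists s s' : int, [/\ `|s| = 1, `|s'| = 1 &
    (forall x y : int, vec q (a * x + c * y) (b * x + d * y)
                      = vec q (s * x) (s' * y))
    \/ (forall x y : int, vec q (a * x + c * y) (b * x + d * y)
                      = vec q (s * y) (s' * x))].
Proof.
move=> q_gt3 isom; have q_gt1 : (1 < q)%N by exact: ltn_trans q_gt3.
have near x y : (dist (vec q x y) 0 <= 1)%N ->
    exists u w : int, [/\ `|u| <= 1, `|w| <= 1
      & vec q (a * x + c * y) (b * x + d * y) = vec q u w].
  by rewrite -isom => /(dist_vec0P q_gt1).
have unit_norm (x y : int) : `|x| <= 1 -> `|y| <= 1 ->
    (dist (vec q x y) 0 <= 1)%N.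
  by move=> x_le y_le; apply/(dist_vec0P q_gt1); exists x, y.
have isom_inj x y : vec q (a * x + c * y) (b * x + d * y) = vec q 0 0 ->
    vec q x y = vec q 0 0.
  move=> E; have : (dist (vec q x y) 0 <= 0)%N.
    by rewrite -isom E; apply/(dist_vec0P q_gt1); exists 0, 0.
  by move=> /(dist_vec0P q_gt1)[u [w [u_le w_le ->]]]; congr vec; lia.
have n0 : `|0 : int| <= 1 by []; have n1 : `|1 : int| <= 1 by [].
have [a' [b' [a'_le b'_le E1]]] := near 1 0 (unit_norm _ _ n1 n0).
have [c' [d' [c'_le d'_le E2]]] := near 0 1 (unit_norm _ _ n0 n1).
have linE (x y : int) : vec q (a * x + c * y) (b * x + d * y)
                        = vec q (a' * x + c' * y) (b' * x + d' * y).
  move/eqP/(vec_eqP q_gt1): E1 => [m [n]].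
  rewrite !mulr1 !mulr0 !addr0 => -[-> ->].
  move/eqP/(vec_eqP q_gt1): E2 => [m' [n']].
  rewrite !mulr1 !mulr0 !add0r => -[-> ->].
  apply/eqP/(vec_eqP q_gt1); exists (m * x + m' * y), (n * x + n' * y).
  by split; ring.
have small (z r : int) : `|z| <= 3 -> z = r * q -> z = 0.
  move=> z_le zE; have [r0 | r_neq0] := eqVneq r 0; first by rewrite zE r0 mul0r.
  have : 4 <= `|r| * q%:Z.
    by apply: (@le_trans _ _ (1 * q%:Z)); [|rewrite ler_wpM2r]; lia.
  have -> : `|r| * q%:Z = `|z| by rewrite zE normrM.
  lia.
(* Congruent integers that differ by at most 3 are equal: the bound on the
   representatives of the image is a bound on the integer a' + c' y. *)
have bound (y : int) : `|y| = 1 -> `|a' + c' * y| <= 1 /\ `|b' + d' * y| <= 1.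
  move=> y1; have y_le : `|y| <= 1 by rewrite y1.
  have [u [w [u_le w_le]]] := near _ _ (unit_norm 1 y n1 y_le).
  rewrite linE !mulr1 => /eqP/(vec_eqP q_gt1)[m [n [uE wE]]].
  have le3 (z z' z'' : int) : `|z| <= 1 -> `|z'| <= 1 -> `|z''| <= 1 ->
      `|z + z' * y - z''| <= 3.
    by clear -y1; have [->|->] := abs1P y1; lia.
  have /eqP : a' + c' * y - u = 0.
    by apply: (small _ m (le3 _ _ _ a'_le c'_le u_le)); rewrite uE addrC addKr.
  have /eqP : b' + d' * y - w = 0.
    by apply: (small _ n (le3 _ _ _ b'_le d'_le w_le)); rewrite wE addrC addKr.
  by rewrite !subr_eq0 => /eqP -> /eqP ->.
have [b1 b1'] := bound 1 (normr1 _); have [b2 b2'] := bound (-1) (normrN1 _).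
have neq0 (x y : int) : vec q x y = vec q 0 0 -> `|x| <= 1 -> `|y| <= 1 ->
    x = 0 /\ y = 0.
  move=> /eqP/(vec_eqP q_gt1)[m [n [xE yE]]] x_le y_le.
  rewrite !add0r in xE yE.
  by split; [apply: (small _ m) | apply: (small _ n)] => //; lia.
have ab0 : ~ (a' = 0 /\ b' = 0).
  case=> a0 b0; suff /neq0/(_ n1 n0)[] : vec q 1 0 = vec q 0 0 by [].
  by apply: isom_inj; rewrite linE a0 b0 !mul0r !mulr0.
have cd0 : ~ (c' = 0 /\ d' = 0).
  case=> c0 d0; suff /neq0/(_ n0 n1)[] : vec q 0 1 = vec q 0 0 by [].
  by apply: isom_inj; rewrite linE c0 d0 !mul0r !mulr0.
rewrite !mulr1 !mulrN1 in b1 b1' b2 b2'.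
have cancel (x y : int) : `|x| <= 1 -> `|y| <= 1 ->
  `|x + y| <= 1 -> `|x - y| <= 1 -> x = 0 \/ y = 0 by clear; lia.
have nz (x : int) : `|x| <= 1 -> x <> 0 -> `|x| = 1 by clear; lia.
have [a0|c0] := cancel a' c' a'_le c'_le b1 b2;
  have [b0|d0] := cancel b' d' b'_le d'_le b1' b2'.
- by case: ab0.
- have c'1 : `|c'| = 1 by apply: nz => // z0; case: cd0.
  have b'1 : `|b'| = 1 by apply: nz => // z0; case: ab0.
  exists c', b'; split=> //; right=> x y.
  by rewrite linE a0 d0 !mul0r addr0 add0r.
- have a'1 : `|a'| = 1 by apply: nz => // z0; case: ab0.
  have d'1 : `|d'| = 1 by apply: nz => // z0; case: cd0.
  exists a', d'; split=> //; left=> x y.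
  by rewrite linE c0 b0 !mul0r addr0 add0r.
- by case: cd0.
Qed.

Definition scale2 (q : nat) (u : int) (v : 'rV['Z_q]_2) : 'rV['Z_q]_2 :=
  \row_j (if j == 0 then v 0 j else v 0 j *~ u).

Lemma scale2_vec (q : nat) (u x y : int) :
  scale2 u (vec q x y) = vec q x (u * y).
Proof.
by apply/rowP=> j; rewrite !mxE; case: eqP; rewrite // -mulrzr -intrM mulrC.
Qed.

Lemma scale2D (q : nat) (u : int) : {morph @scale2 q u : x y / x + y}.
Proof. by move=> x y; apply/rowP=> j; rewrite !mxE mulrzDl; case: eqP. Qed.

Lemma scale2K (q : nat) (u w : int) : (1 < q)%N -> (q %| w * u - 1)%Z ->
  cancel (@scale2 q u) (scale2 w).
Proof.
move=> q_gt1 dvd_wu v; have [x [y ->]] := vec_surj v.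
apply/eqP; rewrite !scale2_vec vec_eq // subrr dvdz0 /=.
have -> : w * (u * y) - y = y * (w * u - 1) by ring.
exact: dvdz_mull.
Qed.

(** * The codes of type 2 *)

Lemma LC_gen (q e h1 : nat) (k : int) :
  LC q e h1 k = (<[vec q (2 * e + 1)%N (k * h1)]>
                 <*> <[vec q 0 (2 * e + 1)%N]>)%g :> {set 'rV['Z_q]_2}.
Proof.
rewrite /= joing_idl joing_idr; congr (generated _).
apply/setP=> v; rewrite !inE.
apply/imsetP/orP=> [[i _ ->] | [] /eqP ->].
- case: i => [[|[|//]]] lt_i; [left|right]; apply/eqP/rowP=> j;
  by rewrite !mxE; case: j => [[|[|//]]] lt_j.
- exists 0; rewrite ?inE //; apply/rowP=> j.
  by rewrite !mxE; case: j => [[|[|//]]] lt_j.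
- exists 1; rewrite ?inE //; apply/rowP=> j.
  by rewrite !mxE; case: j => [[|[|//]]] lt_j.
Qed.

Section Codes.
Variables e t q d1 h1 : nat.
Hypotheses (t_gt1 : (1 < t)%N) (qE : q = ((2 * e + 1) * t)%N)
  (d1E : d1 = gcdn (2 * e + 1) t) (h1E : h1 = ((2 * e + 1) %/ d1)%N).

Notation p := (2 * e + 1)%N.
Notation LC := (LC q e h1).

Let q_gt1 : (1 < q)%N. Proof. by rewrite qE; lia. Qed.
Let d1_gt0 : (0 < d1)%N. Proof. by rewrite d1E gcdn_gt0 addn1. Qed.
Let pE : p = (h1 * d1)%N.
Proof. by rewrite h1E divnK // d1E dvdn_gcdl. Qed.

Let h1_gt0 : (0 < h1)%N.
Proof.
have : (0 < 2 * e + 1)%N by rewrite addn1.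
by rewrite pE muln_gt0 d1_gt0 andbT.
Qed.

Lemma p_dvd_h1 (z : int) : (p %| z * h1)%Z = (d1 %| z)%Z.
Proof.
by rewrite [in p%:Z]pE mulnC PoszM dvdz_mul2r // eqz_nat -lt0n.
Qed.

(** Because h1 and t/d1 are coprime. *)
Lemma p_dvd_t (z : int) : (p %| t%:Z * z)%Z = (h1 %| z)%Z.
Proof.
have tE : t = (t %/ d1 * d1)%N by rewrite divnK // d1E dvdn_gcdr.
have cop : coprimez h1 (t %/ d1)%N.
  rewrite coprimezE /=.
  rewrite /coprime -(eqn_pmul2r d1_gt0) muln_gcdl -tE -pE mul1n.
  by rewrite d1E.
rewrite [in p%:Z]pE [in LHS]tE !PoszM -mulrA [d1%:Z * z]mulrC mulrA.
by rewrite dvdz_mul2r ?Gauss_dvdzr //; lia.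
Qed.

(** The two coordinates are equal as integers, not only modulo q: the lattice
spanned by (p, k h1) and (0, p) contains (q, 0), because p divides t h1. *)
Lemma mem_LC (k x y : int) :
  reflect (exists a b : int, x = a * p /\ y = a * (k * h1) + b * p)
          (vec q x y \in LC k).
Proof.
have LC_E : LC k = (<[vec q p (k * h1)]> * <[vec q 0 p]>)%g :> {set _}.
  rewrite LC_gen cent_joinEr //.
  by apply/centsP=> u _ v _; apply: FinRing.zmod_mulgC.
apply: (iffP idP) => [|[a [b [-> ->]]]].
  rewrite -[_ \in _]/(_ \in (LC k : {set _})) LC_E.
  case/mulsgP => _ _ /cycleP[m ->] /cycleP[n ->].
  rewrite !FinRing.zmodXgE FinRing.zmodMgE !vecMn vecD => /eqP.
  move=> /(vec_eqP q_gt1)[a [b [-> ->]]].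
  have /dvdzP[s sE] : (p %| t%:Z * h1)%Z by rewrite p_dvd_t.
  exists (m%:Z + a * t), (n%:Z + b * t - a * k * s).
  rewrite qE PoszM; split; first by ring.
  have -> : (m%:Z + a * t) * (k * h1)
            = m%:Z * (k * h1) + a * k * (t%:Z * h1) by ring.
  by rewrite sE; ring.
have r0_LC : vec q p (k * h1) \in LC k.
  rewrite -[_ \in _]/(_ \in (LC k : {set _})) LC_E.
  by rewrite -[X in X \in _]mulg1 mem_mulg ?cycle_id.
have r1_LC : vec q 0 p \in LC k.
  rewrite -[_ \in _]/(_ \in (LC k : {set _})) LC_E.
  by rewrite -[X in X \in _]mul1g mem_mulg ?cycle_id.
have -> : vec q (a * p) (a * (k * h1) + b * p)
          = vec q (a * p) (a * (k * h1)) + vec q (b * 0) (b * p).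
  by rewrite vecD mulr0 addr0.
by apply: groupM; apply: group_vecMz.
Qed.

Lemma LC_eqP (k l : int) : reflect (LC k = LC l) (d1 %| k - l)%Z.
Proof.
apply: (iffP idP) => [/dvdzP[c cE] | eqLC].
  suff sub (k1 k2 c1 : int) : k1 - k2 = c1 * d1 -> LC k1 \subset LC k2.
    apply/group_inj/eqP; rewrite eqEsubset (sub _ _ c) //=.
    by rewrite (sub _ _ (- c)) // mulNr -cE opprB.
  move=> c1E; apply/subsetP=> v; have [x [y ->]] := vec_surj v.
  move=> /mem_LC[a [b [-> ->]]]; apply/mem_LC; exists a, (b + a * c1).
  split=> //; have -> : k1 = k2 + c1 * d1 by rewrite -c1E; ring.
  by rewrite [in p%:Z]pE PoszM; ring.
have : vec q p (k * h1) \in LC l.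
  by rewrite -eqLC; apply/mem_LC; exists 1, 0; rewrite !mul1r mul0r addr0.
move=> /mem_LC[a [b [aE kE]]].
have a1 : a = 1 by apply: (@mulIf _ p%:Z); [lia | rewrite mul1r -aE].
rewrite -p_dvd_h1; apply/dvdzP; exists b.
by rewrite mulrBl kE a1; ring.
Qed.

Lemma vec0p_LC k : vec q 0 p \in LC k.
Proof. by apply/mem_LC; exists 0, 1; rewrite !mul0r mul1r add0r. Qed.

Lemma mem_LPLo (C : {group 'rV['Z_q]_2}) :
  (C \in LPLo e q) = (C \in LPL 2 q e) && (vec q 0 p \in C).
Proof.
rewrite inE; congr (_ && _).
have shiftE : delta_mx 0 1 *+ p = vec q 0 p.
  apply/rowP=> j; rewrite mulmxnE !mxE /=.
  by case: j => [[|[|//]]] lt_j; rewrite /= ?mul0rn.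
rewrite shiftE; apply/subsetP/idP => [sub | v_C _ /imsetP[c c_C ->]].
  by apply: sub; apply/imsetP; exists 0; rewrite ?add0r ?(group1 C).
exact: groupM.
Qed.

(** Covering: round the first coordinate to a multiple of p, then the second one
to a word of the column so found.  Packing: for a word of size less than p, the
first coordinate is a multiple of p, hence 0, and then so is the second. *)
Lemma LC_LPLo k : LC k \in LPLo e q.
Proof.
rewrite mem_LPLo vec0p_LC andbT inE; apply/andP; split.
  rewrite cardG_gt1; apply/trivgPn; exists (vec q 0 p); first exact: vec0p_LC.
  rewrite -[1%g](vec00 q) vec_eq // subrr dvdz0 subr0 /= dvdzE /= qE.
  by apply/negP => /dvdn_leq; nia.
apply/(perfectP q_gt1); split=> x y.
  have near (z : int) : exists a : int, `|z - a * p| <= e%:Z.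
    exists ((z + e) %/ p)%Z.
    have := divz_eq (z + e) p.
    have := @modz_ge0 (z + e) p; have := @ltz_pmod (z + e) p; lia.
  have [a a_le] := near x; have [b b_le] := near (y - a * (k * h1)).
  exists (a * p), (a * (k * h1) + b * p); split=> //; last by rewrite opprD addrA.
  by apply/mem_LC; exists a, b.
move=> /mem_LC[a [b [-> ->]]] x_le y_le.
have small (z : int) : `|z * p| <= (2 * e)%N%:Z -> z = 0 by nia.
have a0 := small _ x_le; rewrite a0 mul0r add0r in y_le *.
by rewrite mul0r (small _ y_le) mul0r vec00.
Qed.

(** The first column to the right of the vertical axis has to be shifted by a
multiple of h1, and this shift determines the whole code. *)
Lemma LC_surj (C : {group 'rV['Z_q]_2}) :
  C \in LPLo e q -> exists k, C = LC k.
Proof.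
rewrite mem_LPLo inE => /andP[/andP[_ /(perfectP q_gt1)[cover sep]] p_C].
(* Reducing y modulo p with the word (0, p) gives a word of size at most 2e. *)
have kernel (x y : int) : vec q x y \in C -> `|x| <= (2 * e)%N%:Z ->
    x = 0 /\ (p %| y)%Z.
  move=> v_C x_le; pose b := (y %/ p)%Z.
  have yE := divz_eq y p.
  have y_ge0 := @modz_ge0 y p; have y_lt := @ltz_pmod y p.
  have r_C : vec q x (y %% p)%Z \in C.
    have -> : vec q x (y %% p)%Z = vec q x y - vec q (b * 0) (b * p).
      by rewrite vecB mulr0 subr0 {2}yE addrC addKr.
    by apply: groupM v_C _; apply/groupVr/group_vecMz.
  have /eqP : vec q x (y %% p)%Z = vec q 0 0.
    by rewrite vec00; apply: sep => //; lia.
  rewrite vec_eq // !subr0 => /andP[/dvdzP[c xE] r_dvd]; split.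
    have c0 : c = 0 by rewrite xE qE PoszM in x_le; nia.
    by rewrite xE c0 mul0r.
  rewrite yE rpredD ?dvdz_mull //; apply: dvdz_trans r_dvd.
  by rewrite qE PoszM dvdz_mulr.
have [x [y [v_C x_le _]]] := cover (e%:Z + 1) 0.
have xE : x = p%:Z.
  have [x_le_2e | x_gt] := lerP x (2 * e)%N%:Z; last by lia.
  have [] := kernel x y v_C; lia.
have /dvdzP[k kE] : (h1 %| y)%Z.
  rewrite -p_dvd_t; have [||//] := kernel 0 (t%:Z * y); last by rewrite normr0.
  have -> : vec q 0 (t%:Z * y) = vec q (t%:Z * x) (t%:Z * y).
    apply/eqP; rewrite vec_eq // subrr dvdz0 xE sub0r qE PoszM mulrC.
    by rewrite rpredN dvdzz.
  exact: group_vecMz.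
rewrite xE kE in v_C.
exists k; apply/group_inj/setP=> v; have [x' [y' ->]] := vec_surj v.
have lattice (a b : int) : vec q (a * p) (a * (k * h1) + b * p) \in C.
  have -> : vec q (a * p) (a * (k * h1) + b * p)
            = vec q (a * p) (a * (k * h1)) + vec q (b * 0) (b * p).
    by rewrite vecD mulr0 addr0.
  by apply: groupM; apply: group_vecMz.
apply/idP/mem_LC => [v'_C | [a [b [-> ->]]] //].
pose a := (x' %/ p)%Z.
have x'E := divz_eq x' p.
have x'_ge0 := @modz_ge0 x' p; have x'_lt := @ltz_pmod x' p.
have [||r0 /dvdzP[b bE]] := kernel (x' %% p)%Z (y' - a * (k * h1)).
- have -> : (x' %% p)%Z = x' - a * p by rewrite {2}x'E addrC addKr.
  by rewrite -vecB; apply: groupM v'_C _; apply/groupVr/group_vecMz.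
- by lia.
by exists a, b; rewrite {1}x'E r0 addr0 -bE addrC subrK.
Qed.

(** * Equivalence of codes *)

Let p_dvd_q : (p %| q%:Z)%Z. Proof. by rewrite dvdzE /= qE dvdn_mulr. Qed.
Let d1_dvd_q : (d1 %| q%:Z)%Z.
Proof. by rewrite dvdzE /= qE d1E dvdn_mulr // dvdn_gcdl. Qed.

(** Both inclusions are the inclusion of the image of the code of l under
[scale2 c] in the code of cl, for c = u and for c = w. *)
Lemma scale2_LC (k u w : int) :
  (q %| w * u - 1)%Z -> LC (u * k) = scale2 u @: LC k :> {set _}.
Proof.
have sub c (l : int) v : v \in LC l -> scale2 c v \in LC (c * l).
  have [x [y ->]] := vec_surj v; rewrite scale2_vec.
  move=> /mem_LC[a [b [-> ->]]]; apply/mem_LC.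
  by exists a, (c * b); split; ring.
move=> dvd_wu; apply/eqP; rewrite eqEsubset; apply/andP; split; last first.
  by apply/subsetP=> _ /imsetP[v v_LC ->]; apply: sub.
apply/subsetP=> v /(sub w) v_LC; apply/imsetP; exists (scale2 w v).
  suff <- : LC (w * (u * k)) = LC k by [].
  apply/LC_eqP; apply: dvdz_trans d1_dvd_q _.
  have -> : w * (u * k) - k = k * (w * u - 1) by ring.
  exact: dvdz_mull.
by rewrite (@scale2K q) // mulrC.
Qed.

Lemma imset_LCP (f : 'rV['Z_q]_2 -> 'rV['Z_q]_2) (k l x y : int) :
  LC k = f @: LC l :> {set _} -> vec q x y \in LC l -> f (vec q x y) \in LC k.
Proof.
by move=> E v_LC; rewrite -[_ \in _]/(_ \in (LC k : {set _})) E imset_f.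
Qed.

Lemma mem_gen_LC (k : int) : vec q p (k * h1) \in LC k.
Proof. by apply/mem_LC; exists 1, 0; rewrite !mul1r mul0r addr0. Qed.

Lemma mem_LC_slope (k x s : int) :
  vec q (s * p) x \in LC k -> (p %| x - s * (k * h1))%Z.
Proof.
move=> /mem_LC[a [b [aE ->]]]; have -> : s = a by nia.
by rewrite addrC addKr dvdz_mull.
Qed.

(** An isometry that exchanges the axes sends (0, p) to (p, 0) up to sign, and
(p, 0) is a word only if d1 divides k. *)
Lemma Gequiv_LCP (k l : int) :
  reflect ((d1 %| k - l)%Z \/ (d1 %| k + l)%Z) (Gequiv (LC k) (LC l)).
Proof.
apply: (iffP exists_inP) => [[f f_isom /eqP E] | dvd].
  have [e0|e_gt0] := posnP e.
    by left; rewrite d1E e0 muln0 add0n gcd1n dvd1z.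
  move: f_isom; rewrite inE => /andP[/forallP fD /forallP fI].
  have {}fD : {morph f : x y / x + y}.
    by move=> x y; have /forallP/(_ y)/eqP := fD x.
  have [a [b [c [d fE]]]] := additive_vec fD.
  have q_gt3 : (3 < q)%N by rewrite qE; nia.
  have [|s [s' [s1 s'1 sE]]] := @signed_permutation q a b c d q_gt3.
    by move=> x y; rewrite -fE; apply/eqP.
  have p_LC := vec0p_LC l.
  have gen_LC := mem_gen_LC l.
  have := imset_LCP E p_LC; have := imset_LCP E gen_LC; rewrite !fE.
  case: sE => sE; rewrite !sE => gen_k p_k.
    have := mem_LC_slope gen_k.
    have -> : s' * (l * h1) - s * (k * h1) = (s' * l - s * k) * h1 by ring.
    rewrite p_dvd_h1 => dvd.
    have [e_s|e_s] : s' = s \/ s' = - s by clear -s1 s'1; lia.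
      left; suff -> : k - l = - s * (s' * l - s * k) by exact: dvdz_mull.
      have -> : - s * (s' * l - s * k) = s * s * (k - l) by rewrite e_s; ring.
      by rewrite abs1_sqr // mul1r.
    right; suff -> : k + l = - s * (s' * l - s * k) by exact: dvdz_mull.
    have -> : - s * (s' * l - s * k) = s * s * (k + l) by rewrite e_s; ring.
    by rewrite abs1_sqr // mul1r.
  have dvd_k : (d1 %| k)%Z.
    have := mem_LC_slope p_k.
    by rewrite mulr0 sub0r rpredN mulrA p_dvd_h1 dvdz_abs1.
  have dvd_l : (d1 %| l)%Z.
    have /mem_LC[m [_ [mE _]]] := gen_k.
    have : (p %| s * l * h1)%Z by rewrite -mulrA mE dvdz_mull.
    by rewrite p_dvd_h1 dvdz_abs1.
  by left; rewrite rpredB.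
have isom u : `|u| = 1 -> [ffun v => @scale2 q u v] \in @linear_isometries 2 q.
  move=> u1; rewrite inE; apply/andP; split.
    by apply/forallP=> x; apply/forallP=> y; rewrite !ffunE scale2D.
  apply/forallP=> v; have [x [y ->]] := vec_surj v; rewrite ffunE scale2_vec.
  rewrite eqn_leq; apply/andP; split; apply/(dist_vec0P q_gt1).
    have := leqnn (dist (vec q x y) 0).
    move=> /(dist_vec0P q_gt1)[a [b [a_le b_le ab]]].
    exists a, (u * b); rewrite normrM u1 mul1r; split=> //.
    by rewrite -!scale2_vec ab.
  have := leqnn (dist (vec q x (u * y)) 0).
  move=> /(dist_vec0P q_gt1)[a [b [a_le b_le ab]]].
  exists a, (u * b); rewrite normrM u1 mul1r; split=> //.
  by rewrite -!scale2_vec -ab !scale2_vec mulrA abs1_sqr // mul1r.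
have [u u1 dvd_u] : exists2 u : int, `|u| = 1 & (d1 %| k - u * l)%Z.
  by case: dvd => dvd; [exists 1 | exists (-1)]; rewrite ?mul1r ?mulN1r ?opprK.
exists [ffun v => @scale2 q u v]; first exact: isom.
have /LC_eqP -> := dvd_u; rewrite (@scale2_LC l u u); last first.
  by rewrite abs1_sqr // subrr.
by apply/eqP/eq_imset => v; rewrite ffunE.
Qed.

(** All the words of the code of l are multiples of h1 gcd(d1, l), a divisor of
q; so are their images under an additive map, in particular (p, k h1). *)
Lemma Aequiv_dvdz (k l : int) (f : {perm 'rV['Z_q]_2}) :
  f \in Aut [set: 'rV['Z_q]_2] -> LC k = f @: LC l :> {set _} ->
  (gcdz d1 l %| k)%Z.
Proof.
move=> fA E; have /morphicP fM := Aut_morphic fA.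
have fD : {morph f : x y / x + y} by move=> x y; apply: fM; rewrite inE.
have [a [b [c [d fE]]]] := additive_vec fD.
have : _ \in (LC k : {set _}) := mem_gen_LC k; rewrite E.
case/imsetP=> w; have [x [y ->]] := vec_surj w.
case/mem_LC=> m [n [-> ->]]; rewrite fE => /eqP/(vec_eqP q_gt1)[_ [j [_ kE]]].
have h1_neq0 : h1%:Z != 0 by have := h1_gt0; lia.
rewrite -(dvdz_mul2r h1_neq0) kE.
have dvd_p : (gcdz d1 l * h1 %| p%:Z)%Z.
  by rewrite pE PoszM mulrC dvdz_mul // dvdz_gcdl.
have dvd_q : (gcdz d1 l * h1 %| q%:Z)%Z := dvdz_trans dvd_p p_dvd_q.
have dvd_l : (gcdz d1 l * h1 %| l * h1)%Z by rewrite dvdz_mul // dvdz_gcdr.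
apply: rpredD; last exact: dvdz_mull.
apply: rpredD; first by do 2!apply: dvdz_mull.
by apply/dvdz_mull/rpredD; apply: dvdz_mull.
Qed.

Lemma Aequiv_LCP (k l : int) :
  reflect (exists2 u : int, coprimez u d1 & (d1 %| k - u * l)%Z)
          (Aequiv (LC k) (LC l)).
Proof.
apply: (iffP exists_inP) => [[f fA /eqP E] | [u0 cop_u0 dvd_u0]].
  apply: associates_mod => //; last exact: Aequiv_dvdz fA E.
  apply: (@Aequiv_dvdz _ _ f^-1%g); first exact: groupVr.
  rewrite E -imset_comp -[LHS]imset_id; apply: eq_imset => v /=.
  by rewrite permK.
have [|u dvd_u cop_u] := @coprimez_lift d1 q u0 _ (ltnW q_gt1) cop_u0.
  by have := d1_dvd_q; rewrite dvdzE.
have [[w z] /= wz] := coprimezP _ _ cop_u.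
have dvd_wu : (q %| w * u - 1)%Z by rewrite -wz opprD addNKr rpredN dvdz_mull.
have inj_u : injective (@scale2 q u) := can_inj (scale2K q_gt1 dvd_wu).
have dvd_ul : (d1 %| k - u * l)%Z.
  have -> : k - u * l = (k - u0 * l) - l * (u - u0) by ring.
  by rewrite rpredB // dvdz_mull.
have E : LC k = perm inj_u @: LC l :> {set _}.
  have /LC_eqP -> := dvd_ul; rewrite (scale2_LC l dvd_wu).
  by apply/eq_imset => v; rewrite permE.
exists (perm inj_u); last exact/eqP.
rewrite inE; apply/andP; split; first by apply/subsetP=> v _; rewrite inE.
by apply/morphicP=> v v' _ _; rewrite !permE; apply: scale2D.
Qed.

End Codes.

(** * Generalized cosets *)

Lemma gcoset_eqP (A : finComPzRingType) (S : {set A}) (k l : A) :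
  1 \in S -> {in S &, forall s s', s * s' \in S} ->
  {in S, forall s, exists2 s', s' \in S & s * s' = 1} ->
  reflect (exists2 s, s \in S & k = l * s) (gcoset k S == gcoset l S).
Proof.
move=> S1 SM SV; apply: (iffP eqP) => [eq_kl | [s s_S ->]].
  have : k \in gcoset k S by apply/imsetP; exists 1; rewrite ?mulr1.
  by rewrite eq_kl => /imsetP[s s_S kE]; exists s.
have [s' s'_S ss'] := SV s s_S.
apply/setP=> x; apply/imsetP/imsetP=> [] [r r_S ->].
  by exists (s * r); [exact: SM | rewrite mulrA].
by exists (s' * r); [exact: SM | rewrite mulrA -(mulrA l) ss' mulr1].
Qed.

Lemma gcoset_pm1P (A : finComPzRingType) (k l : A) :
  reflect (k = l \/ k = - l)
          (gcoset k [set 1; -1] == gcoset l [set 1; -1]).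
Proof.
have SP (s : A) : reflect (s = 1 \/ s = -1) (s \in [set 1; -1]).
  rewrite !inE.
  by apply: (iffP orP) => [[/eqP-> | /eqP->] | [-> | ->]]; auto.
apply: (iffP (gcoset_eqP _ _ _ _ _)).
- by apply/SP; left.
- move=> s s' /SP s1 /SP s'1; apply/SP.
  by case: s1 s'1 => -> [] ->; rewrite ?mulN1r ?mul1r ?opprK; auto.
- move=> s /SP s1; exists s; first exact/SP.
  by case: s1 => ->; rewrite ?mulrNN mulr1.
- by case=> s /SP[] -> ->; rewrite ?mulrN mulr1; auto.
- case=> ->; [exists 1 | exists (-1)]; rewrite ?mulrN ?mulr1 //.
    by apply/SP; left.
  by apply/SP; right.
Qed.

Lemma gcoset_unitP (A : finComPzRingType) (k l : A) :
  reflect (exists2 u, u \in unit_set A & k = l * u)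
          (gcoset k (unit_set A) == gcoset l (unit_set A)).
Proof.
have UP (u : A) : reflect (exists u', u * u' = 1) (u \in unit_set A).
  by rewrite inE; apply: (iffP existsP) => -[u' /eqP uu']; exists u'.
apply: gcoset_eqP.
- by apply/UP; exists 1; rewrite mulr1.
- move=> u v /UP[u' uu'] /UP[v' vv']; apply/UP; exists (u' * v').
  by rewrite mulrACA uu' vv' mulr1.
- by move=> u /UP[u' uu']; exists u' => //; apply/UP; exists u; rewrite mulrC.
Qed.

Lemma unit_set_intr (d : nat) (u : int) : (0 < d)%N ->
  (u%:~R \in unit_set (Zmod d)) = coprimez u d.
Proof.
move=> d_gt0; rewrite inE; apply/existsP/coprimezP => [[v] | [[v w] /= vw]].
  rewrite -(intr_val_Zmod v) -[1]/(1%:~R) -intrM intr_Zmod_eq //.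
  move=> /dvdzP[w wE]; exists ((v : nat)%:Z, - w) => /=.
  by rewrite mulNr -wE; ring.
exists v%:~R; rewrite -[1]/(1%:~R) -intrM intr_Zmod_eq //.
by apply/dvdzP; exists (- w); rewrite -vw; ring.
Qed.

(** On X the relation R is the image under psi of the relation of having the
same coset, so its classes are the images of the cosets. *)
Lemma induced_bijection (A : finComPzRingType) (T : finType) (S : {set A})
    (X : {set T}) (R : rel T) (psi : A -> T) :
  bij_between [set: A] X psi ->
  (forall k l, R (psi k) (psi l) = (gcoset k S == gcoset l S)) ->
  exists psiS : {set A} -> {set T},
    (forall k, psiS (gcoset k S) = eq_class R X (psi k))
    /\ bij_between (gcosets S) (equivalence_partition R X) psiS.
Proof.
move=> [_ psiX] RE.
have psi_X k : psi k \in X by rewrite -psiX imset_f.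
have classE k l : (eq_class R X (psi k) == eq_class R X (psi l))
                  = (gcoset k S == gcoset l S).
  apply/eqP/eqP=> [/setP/(_ (psi l)) | eq_kl].
    by rewrite !inE psi_X !RE eqxx => /eqP.
  apply/setP=> y; rewrite !inE; case y_X : (y \in X) => //=.
  by move: y_X; rewrite -psiX => /imsetP[j _ ->]; rewrite !RE eq_kl.
pose psiS (B : {set A}) :=
  if [pick k | gcoset k S == B] is Some k then eq_class R X (psi k) else set0.
have psiSE k : psiS (gcoset k S) = eq_class R X (psi k).
  rewrite /psiS; case: pickP => [l eq_lk | /(_ k)]; last by rewrite eqxx.
  by apply/eqP; rewrite classE.
exists psiS; split=> //; split.
  move=> _ _ /imsetP[k _ ->] /imsetP[l _ ->]; rewrite !psiSE => /eqP.
  by rewrite classE => /eqP.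
apply/setP=> B; apply/imsetP/imsetP=> [[_ /imsetP[k _ ->] ->] | [x]].
  by exists (psi k); rewrite ?psiSE.
rewrite -{1}psiX => /imsetP[k _ ->] ->.
by exists (gcoset k S); [exact: imset_f | rewrite psiSE].
Qed.

(** * The classification *)

Theorem theorem3p22 (e t q d1 h1 : nat) (ht : (1 < t)%N)
    (hq : q = ((2 * e + 1) * t)%N)
    (hd1 : d1 = gcdn (2 * e + 1) t)
    (hh1 : h1 = ((2 * e + 1) %/ d1)%N) :
  exists psi : Zmod d1 -> {group 'rV['Z_q]_2},
    [/\ forall k : int, psi k%:~R = LC q e h1 k,
        bij_between [set: Zmod d1] (LPLo e q) psi,
        exists psiG : {set Zmod d1} -> {set {group 'rV['Z_q]_2}},
          (forall k : Zmod d1,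
             psiG (gcoset k [set 1; -1]) = eq_class Gequiv (LPLo e q) (psi k))
          /\ bij_between (gcosets [set 1; -1])
               (equivalence_partition Gequiv (LPLo e q)) psiG
      & exists psiA : {set Zmod d1} -> {set {group 'rV['Z_q]_2}},
          (forall k : Zmod d1,
             psiA (gcoset k (unit_set (Zmod d1)))
             = eq_class Aequiv (LPLo e q) (psi k))
          /\ bij_between (gcosets (unit_set (Zmod d1)))
               (equivalence_partition Aequiv (LPLo e q)) psiA].
Proof.
have d1_gt0 : (0 < d1)%N by rewrite hd1 gcdn_gt0 addn1.
pose lift (k : Zmod d1) : int := (k : nat)%:Z.
have liftK k : (lift k)%:~R = k by apply: intr_val_Zmod.
pose psi (k : Zmod d1) := LC q e h1 (lift k).
have psiE (k : int) : psi k%:~R = LC q e h1 k.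
  by apply/(LC_eqP ht hq hd1 hh1); rewrite -intr_Zmod_eq // liftK.
have psi_bij : bij_between [set: Zmod d1] (LPLo e q) psi.
  split=> [k l _ _ /(LC_eqP ht hq hd1 hh1) |].
    by rewrite -intr_Zmod_eq // !liftK => /eqP.
  apply/setP=> C; apply/imsetP/idP=> [[k _ ->] | /(LC_surj ht hq hd1 hh1)[k ->]].
    exact: LC_LPLo ht hq hd1 hh1 _.
  by exists k%:~R; [rewrite inE | rewrite psiE].
have dvd_lift (k l : Zmod d1) (u : int) :
    (d1 %| lift k - u * lift l)%Z = (k == l * u%:~R).
  by rewrite -intr_Zmod_eq // intrM !liftK mulrC.
exists psi; split=> //; apply: induced_bijection => // k l.
  have dvd_sub : (d1 %| lift k - lift l)%Z = (k == l).
    by rewrite -intr_Zmod_eq // !liftK.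
  have dvd_add : (d1 %| lift k + lift l)%Z = (k == - l).
    by rewrite -[lift l]opprK -intr_Zmod_eq // mulrNz !liftK.
  apply/(Gequiv_LCP ht hq hd1 hh1)/gcoset_pm1P; rewrite dvd_sub dvd_add.
    by case=> /eqP; auto.
  by case=> /eqP; auto.
apply/(Aequiv_LCP ht hq hd1 hh1)/gcoset_unitP => [[u cop_u] | [u u_unit ->]].
  rewrite dvd_lift => /eqP kE; exists u%:~R => //.
  by rewrite unit_set_intr.
exists (lift u); first by rewrite -unit_set_intr // liftK.
by rewrite dvd_lift liftK.
Qed.
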